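(* Let $k\geq 1$ and $t\ge 1$ be integers. The following square is a pull-back (cartesian) diagram of spaces: $$\begin{array}{ccc} M(t,k) & \longrightarrow & \mathrm{Conf}\bigl(\mathbb C,\binom{k}{t}\bigr)\\ \downarrow & & \downarrow {\scriptstyle j}\\ \mathrm{Conf}(\mathbb C,k) & \xrightarrow{\ \Theta_t\ } & \mathbb C^{\binom{k}{t}}\end{array}$$ where the left vertical map and $j$ are the natural inclusions, and the top map is the restriction of $\Theta_t$.
   Context: $\mathrm{Conf}(\mathbb C,m)$ is the space of ordered $m$-tuples of pairwise distinct points of $\mathbb C$ (a single point if $m=0$). The space $M(t,k)$: if $k>t$, it is the subspace of $\mathbb C^k$ of all $(x_1,\ldots,x_k)$ such that $\frac1t\sum_{i\in I}x_i\neq\frac1t\sum_{j\in J}x_j$ for all pairs of distinct $t$-element subsets $I\neq J$ of $\{1,\ldots,k\}$ (this is contained in $\mathrm{Conf}(\mathbb C,k)$); if $k\le t$, then $M(t,k)=\mathrm{Conf}(\mathbb C,k)$. The map $\Theta_t\colon \mathrm{Conf}(\mathbb C,k)\to\mathbb C^{\binom kt}$ sends $(z_1,\ldots,z_k)$ to the tuple whose coordinates, indexed by the sequences $i_1<i_2<\cdots<i_t$ in $\{1,\ldots,k\}$ ordered lexicographically, are $z_{i_1}+z_{i_2}+\cdots+z_{i_t}$. *)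

(* Defs.v *)
From HB Require Import structures.
From mathcomp Require Import all_boot all_order all_algebra complex.
From mathcomp Require Import all_classical all_reals all_analysis.

Set Implicit Arguments.
Unset Strict Implicit.
Unset Printing Implicit Defensive.

Import Order.TTheory GRing.Theory Num.Theory.
Import numFieldNormedType.Exports.

Local Open Scope classical_set_scope.
Local Open Scope ring_scope.

(* Cartesian square of topological spaces, by the universal property; the test
   spaces [T] may be empty, as a [topologicalType] need not be pointed. *)
Definition is_pullback (P X Y Z : topologicalType)
    (p : P -> X) (q : P -> Y) (f : X -> Z) (g : Y -> Z) : Prop :=
  [/\ continuous p, continuous q, continuous f, continuous g &
      f \o p = g \o q /\
      forall (T : topologicalType) (u : T -> X) (v : T -> Y),
        continuous u -> continuous v -> f \o u = g \o v ->
        exists! w : T -> P, [/\ continuous w, p \o w = u & q \o w = v]].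

(* [C^m] is ['rV[R[i]^o]_m] with the product topology; [R[i]^o] is [R[i]] with
   the topology of its norm.  When a set such as [Conf R m] is used as a type,
   that type carries the subspace topology and [set_val] is its inclusion. *)
Definition Conf (R : realType) (m : nat) : set 'rV[R[i]^o]_m :=
  [set x | forall i j : 'I_m, i != j -> x 0 i != x 0 j].
Arguments Conf : clear implicits.

Definition M (R : realType) (t k : nat) : set 'rV[R[i]^o]_k :=
  if (t < k)%N then
    [set x : 'rV_k | forall I J : {set 'I_k}, #|I| = t -> #|J| = t -> I != J ->
       t%:R^-1 * (\sum_(i in I) x 0 i) != t%:R^-1 * (\sum_(j in J) x 0 j)]
  else Conf R k.
Arguments M : clear implicits.

Definition incr_tuples (t k : nat) : {set t.-tuplelexi 'I_k} :=
  [set s : t.-tuplelexi 'I_k | sorted ltn (map val s)].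

Lemma card_incr_tuples t k : #|incr_tuples t k| = 'C(k, t).
Proof. exact: card_ltn_sorted_tuples. Qed.

(* The [a]-th sequence [i_1 < ... < i_t] in lexicographic order:
   [Order.enum_val] is the increasing enumeration for [t.-tuplelexi]. *)
Definition lexseq (t k : nat) (a : 'I_('C(k, t))) : t.-tuple 'I_k :=
  Order.enum_val (cast_ord (esym (card_incr_tuples t k)) a).

Definition Theta (R : realType) (t k : nat) (z : Conf R k) :
    'rV[R[i]^o]_('C(k, t)) :=
  \row_a \sum_(p < t) set_val z 0 (tnth (lexseq a) p).

(* Main.v *)
(** The coordinates of [Theta_t z] are the sums of [z] over the [t]-element
    subsets of the index set, each subset occurring exactly once; so [Theta_t z]
    has distinct coordinates iff [z] lies in [M(t,k)], i.e. [M(t,k)] is the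
    preimage of [Conf(C, binom(k,t))] under the continuous map [Theta_t], with
    the subspace topology.  For [t < k], [M(t,k)] lies in [Conf(C,k)] because,
    given [i != j], a [(t-1)]-set [S] avoiding both exists and the sums over
    [S + i] and [S + j] differ by [x_i - x_j]. *)
Require Import Defs.
From mathcomp Require Import all_boot all_order all_algebra complex.
From mathcomp Require Import all_classical all_reals all_analysis.

Import numFieldNormedType.Exports.
Local Open Scope classical_set_scope.
Local Open Scope ring_scope.

Import GRing.Theory Num.Theory.

Section LexSet.
Variables t k : nat.

Definition lexset (a : 'I_('C(k, t))) : {set 'I_k} := [set i in lexseq a].

Lemma lexseq_sorted (a : 'I_('C(k, t))) : sorted ltn (map val (lexseq a)).
Proof.
have := Order.enum_valP (cast_ord (esym (card_incr_tuples t k)) a).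
by rewrite inE.
Qed.

Lemma lexseq_uniq (a : 'I_('C(k, t))) : uniq (lexseq a).
Proof.
rewrite -(map_inj_uniq val_inj).
exact: (sorted_uniq ltn_trans ltnn (lexseq_sorted a)).
Qed.

Lemma card_lexset (a : 'I_('C(k, t))) : #|lexset a| = t.
Proof. by rewrite cardsE (card_uniqP (lexseq_uniq a)) size_tuple. Qed.

(** A strictly increasing sequence is recovered from its set of entries by sorting, and the
    enumeration [lexseq] does not repeat. *)
Lemma lexset_inj : injective lexset.
Proof.
move=> a b /setP eq_ab.
have eq_mem : map val (lexseq a) =i map val (lexseq b).
  by apply: eq_mem_map => i; have := eq_ab i; rewrite !inE.
have eq_map := irr_sorted_eq ltn_trans ltnn (lexseq_sorted a)
  (lexseq_sorted b) eq_mem.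
have eq_seq : lexseq a = lexseq b by apply/val_inj/(inj_map val_inj).
exact: (cast_ord_inj (@Order.enum_val_inj _ _ (incr_tuples t k) _ _ eq_seq)).
Qed.

(** Counting: the injection [lexset] goes from ['C(k, t)] indices into the [t]-element subsets, of
    which there are equally many. *)
Lemma lexset_surj (A : {set 'I_k}) : #|A| = t -> exists a, lexset a = A.
Proof.
move=> cardA.
pose D := [set B : {set 'I_k} | #|B| == t]%SET.
have /setP/(_ A) : (lexset @: 'I_('C(k, t)) = D)%SET.
  apply/eqP; rewrite eqEcard card_imset; last exact: lexset_inj.
  rewrite card_draws !card_ord leqnn andbT.
  by apply/fintype.subsetP => _ /imsetP[a _ ->]; rewrite inE card_lexset.
by rewrite inE cardA eqxx => /imsetP[a _ ->]; exists a.
Qed.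

End LexSet.

Section Square.
Variables (R : realType) (t k : nat).

Lemma ThetaE (z : Conf R k) (a : 'I_('C(k, t))) :
  Theta t z 0 a = \sum_(i in lexset t k a) set_val z 0 i.
Proof.
rewrite mxE -(big_tuple _ _ _ xpredT (fun i => set_val z 0 i)).
by rewrite big_uniq ?lexseq_uniq //; apply: eq_bigl => i; rewrite inE.
Qed.

Lemma M_Conf (ht : (0 < t)%N) (x : 'rV[R[i]^o]_k) : M R t k x -> Conf R k x.
Proof.
rewrite /M; case: ifP => // ltk /= Mx i j neq_ij.
have [S [Scard iS jS]] : exists S : {set 'I_k},
    [/\ #|S| = t.-1, i \notin S & j \notin S].
  (* Since [0 < t < k], the complement of [{i, j}] has [k - 2 >= t - 1] elements, enough to choose
     [S] inside it. *)
  have : (t.-1 <= #|~: [set i; j]%SET|)%N.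
    rewrite -(leq_add2l #|[set i; j]%SET|) cardsC card_ord cards2 neq_ij.
    by rewrite -(prednK ht) in ltk.
  case/card_geqP => s [us <- sS].
  exists [set x in s]%SET; split; first by rewrite cardsE; apply/card_uniqP.
    by rewrite inE; apply/negP => /sS; rewrite !inE eqxx.
  by rewrite inE; apply/negP => /sS; rewrite !inE eqxx orbT.
have cardU l : l \notin S -> #|l |: S|%SET = t.
  by move=> lS; rewrite cardsU1 lS Scard add1n prednK.
have neqU : (i |: S != j |: S)%SET.
  apply/eqP => /setP /(_ i).
  by rewrite !inE eqxx (negbTE iS) (negbTE neq_ij).
have := Mx _ _ (cardU _ iS) (cardU _ jS) neqU.
by apply: contra_neq => eq_x; rewrite !big_setU1 //= eq_x.
Qed.

Lemma Theta_Conf (ht : (0 < t)%N) (z : Conf R k) :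
  Conf R 'C(k, t) (Theta t z) <-> M R t k (set_val z).
Proof.
have tV : (t%:R^-1 : R[i]) != 0 by rewrite invr_eq0 pnatr_eq0 -lt0n.
rewrite /M; case: ifPn => [ltk|]; last first.
  (* For [k <= t] there is at most one coordinate, so distinctness is vacuous on the left; on the
     right it is carried by the type of [z]. *)
  rewrite -leqNgt => lekt; split=> _; first exact: set_valP.
  have C1 : ('C(k, t) <= 1)%N.
    by move: lekt; rewrite leq_eqVlt => /orP[/eqP->|/bin_small->//]; rewrite binn.
  move=> a b /eqP[]; apply: val_inj => /=.
  have := leq_trans (ltn_ord a) C1; have := leq_trans (ltn_ord b) C1.
  by rewrite !ltnS !leqn0 => /eqP-> /eqP->.
(* The nonzero factor [t%:R^-1] cancels, so averages over subsets differ exactly when the sums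
   do. *)
split=> [inj I J /lexset_surj[a <-] /lexset_surj[b <-] neq_ab|inj a b neq_ab].
  rewrite (inj_eq (mulfI tV)) -!ThetaE; apply: inj.
  by apply: contraNneq neq_ab => ->.
rewrite !ThetaE -(inj_eq (mulfI tV)).
by apply: inj; rewrite ?card_lexset ?(inj_eq (@lexset_inj t k)).
Qed.

End Square.

Lemma continuous_set_val (X : topologicalType) (A : set X) :
  continuous (set_val : A -> X).
Proof. exact: initial_continuous. Qed.

Lemma continuous_to_set (X T : topologicalType) (A : set X) (w : T -> A) :
  continuous (set_val \o w) -> continuous w.
Proof. exact: continuous_comp_initial. Qed.

(** A neighbourhood of a row contains a box of neighbourhoods of its entries, and finitely many
    conditions that each hold near [x] hold there jointly. *)
Lemma continuous_row (K T : topologicalType) (n : nat) (f : T -> 'rV[K]_n) :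
  (forall j, continuous (fun x => f x 0 j)) -> continuous f.
Proof.
move=> cf x B [P nP sPB]; rewrite nbhs_simpl /=.
have : \forall y \near x, forall j, P 0 j (f y 0 j).
  by apply: filter_forall => j; exact: cf (nP 0 j).
by apply: filterS => y Py; apply: sPB => i j; rewrite (ord1 i).
Qed.

Lemma continuous_Theta (R : realType) (t k : nat) : continuous (@Theta R t k).
Proof.
apply: continuous_row => a.
have -> : (fun z : Conf R k => Theta t z 0 a) =
    (fun z => \sum_(p < t) set_val z 0 (tnth (lexseq a) p)).
  by apply/funext => z; rewrite mxE.
apply: continuous_big => [|p _ z]; first exact: add_continuous.
apply: (@continuous_comp _ _ _ set_val (fun x : 'rV[R[i]^o]_k => x 0 _)).
  exact: continuous_set_val.
exact: coord_continuous.
Qed.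

Theorem proposition1p1 (R : realType) (k t : nat) (hk : (1 <= k)%N)
    (ht : (1 <= t)%N) :
  exists (incl : M R t k -> Conf R k) (top : M R t k -> Conf R 'C(k, t)),
    [/\ forall x, set_val (incl x) = set_val x,
        forall x, set_val (top x) = Theta t (incl x) &
        is_pullback incl top (@Theta R t k) set_val].
Proof.
pose incl (x : M R t k) : Conf R k :=
  SigSub (mem_set (M_Conf R t k ht _ (set_valP x))).
have inclE x : set_val (incl x) = set_val x by [].
have ThetaM x : Conf R 'C(k, t) (Theta t (incl x)).
  by apply/Theta_Conf => //; rewrite inclE; exact: set_valP.
pose top (x : M R t k) : Conf R 'C(k, t) := SigSub (mem_set (ThetaM x)).
have topE x : set_val (top x) = Theta t (incl x) by [].
have incl_cont : continuous incl.
  by apply: continuous_to_set; exact: continuous_set_val.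
exists incl, top; split=> //; split=> //.
- apply: continuous_to_set => x.
  by apply: (continuous_comp (incl_cont x)); exact: continuous_Theta.
- exact: continuous_Theta.
- exact: continuous_set_val.
split=> // T u v cu cv uv.
(* By commutativity [Theta t (u x)] is the configuration [v x], which forces [u x] into
   [M R t k]. *)
have Mu x : M R t k (set_val (u x)).
  by apply/Theta_Conf => //; have /= -> := congr1 (@^~ x) uv; exact: set_valP.
pose w x : M R t k := SigSub (mem_set (Mu x)).
have inclw : incl \o w = u by apply/funext => x; exact: val_inj.
exists w; split.
  split=> //.
    apply: continuous_to_set => x.
    by apply: (continuous_comp (cu x)); exact: continuous_set_val.
  (* The inclusion of [Conf R 'C(k, t)] is injective, so this equality reduces to [uv]. *)
  apply/funext => x; apply: val_inj.
  rewrite -[LHS]/(Theta t ((incl \o w) x)) inclw.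
  exact: (f_equal (fun f => f x) uv).
(* Uniqueness: [incl] keeps the underlying row, so [incl \o w' = u] alone determines [w']. *)
move=> w' [_ inclw' _]; apply/funext => x; apply: val_inj.
by rewrite -[RHS]inclE -[incl (w' x)]/((incl \o w') x) inclw'.
Qed.
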